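(* Let $\Sigma$ be a compact topological group acting measurably from the left on a measurable space $\mathcal X$, and let $\mathcal P$ be the set of all $\Sigma$-invariant probability measures on $\mathcal X$. Let $\mathcal F$ be a separating set for the space $\mathcal M$ of finite signed measures on $\mathcal X$, and let $\Sigma_0$ be a generating set for $\Sigma$. A probability measure $\mu$ on $\mathcal X$ belongs to $\mathcal P$ if and only if $$\int_{\mathcal X}(f(\sigma x)-f(x))\,\mu(dx)=0\quad\text{for all }\sigma\in\Sigma_0\text{ and }f\in\mathcal F.$$ In other words, $\mathcal P$ is the hypothesis generated by the constraint set $$\Phi=\{\sigma^*f-f:\sigma\in\Sigma_0,\ f\in\mathcal F\cup(-\mathcal F)\}.$$
   Context: A left action of $\Sigma$ on $\mathcal X$ assigns to each $\sigma\in\Sigma$ a map $x\mapsto\sigma x$ on $\mathcal X$, with the identity element inducing the identity map and $(\sigma_1\sigma_2)x=\sigma_1(\sigma_2x)$. The action is measurable if $(\sigma,x)\mapsto\sigma x$ is jointly measurable, where $\Sigma$ carries its Borel $\sigma$-algebra. For $\sigma\in\Sigma$, $\sigma_*\mu$ is the pushforward of $\mu$ under $x\mapsto\sigma x$, and $(\sigma^*f)(x)=f(\sigma x)$. $\mathcal P=\{\mu\text{ probability measure on }\mathcal X:\mu=\sigma_*\mu\text{ for all }\sigma\in\Sigma\}$. A set $\mathcal F$ of bounded measurable (real-valued) functions on $\mathcal X$ is a separating set for $\mathcal M$ if, for any $\mu\in\mathcal M$, one has $\mu=0$ if and only if $\int f\,d\mu=0$ for all $f\in\mathcal F$. A generating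 set for $\Sigma$ is a subset $\Sigma_0\subset\Sigma$ such that any $\sigma\in\Sigma$ can be expressed as $\sigma=\sigma_1\sigma_2\cdots\sigma_n$ for some $n\in\{1,2,\dots\}$ and $\sigma_1,\dots,\sigma_n\in\Sigma_0$. The hypothesis generated by a set $\Phi$ of real-valued measurable functions is the set of probability measures $\mu$ on $\mathcal X$ such that $\int|f|\,d\mu<\infty$ and $\int f\,d\mu\le 0$ for all $f\in\Phi$. *)

(* Defs.v *)
From HB Require Import structures.
From mathcomp Require Import all_boot all_order all_algebra.
From mathcomp Require Import all_classical all_reals all_analysis.

Set Implicit Arguments.
Unset Strict Implicit.
Unset Printing Implicit Defensive.

Import Order.TTheory GRing.Theory Num.Theory.
Import numFieldNormedType.Exports.

Local Open Scope classical_set_scope.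
Local Open Scope ring_scope.

HB.mixin Record isTopologicalGroup G & Topological G & Group G := {
  mulg_continuous : continuous (fun p : G * G => (p.1 * p.2)%g) ;
  invg_continuous : continuous (fun x : G => (x^-1)%g)
}.

#[short(type="topologicalGroupType")]
HB.structure Definition TopologicalGroup :=
  {G of Topological G & Group G & isTopologicalGroup G}.

(* Measurable types are pointed in the library, topological groups are not:
   the alias [pointed_group G] points G at its identity. *)
Definition pointed_group (G : topologicalGroupType) : Type := G.
HB.instance Definition _ (G : topologicalGroupType) :=
  Choice.on (pointed_group G).
HB.instance Definition _ (G : topologicalGroupType) :=
  isPointed.Build (pointed_group G) (1%g : G).

Definition borel_group (G : topologicalGroupType) :=
  g_sigma_algebraType ((@open G) : set (set (pointed_group G))).

Definition left_action (G : groupType) (X : Type) (act : G -> X -> X) : Prop :=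
  (forall x, act 1%g x = x) /\
  (forall s t x, act (s * t)%g x = act s (act t x)).

Definition measurable_action (G : topologicalGroupType) d
    (X : measurableType d) (act : G -> X -> X) : Prop :=
  measurable_fun [set: borel_group G * X] (fun p => act p.1 p.2).

Definition generating_set (G : groupType) (S : set G) : Prop :=
  forall g : G, exists n (s : 'I_n -> G),
    [/\ (0 < n)%N, forall i, S (s i) & g = (\prod_(i < n) s i)%g].

Section measures.
Context d (X : measurableType d) (R : realType).

(* By [Hahn_decomposition_uniq], the measures [jordan_pos] and [jordan_neg]
   do not depend on the chosen Hahn decomposition. *)
Definition charge_integral (nu : charge X R) (f : X -> R) :
    \bar R :=
  let nuPN := projT2 (cid (projT2 (cid (Hahn_decomposition nu)))) in
  (\int[jordan_pos nuPN]_x (f x)%:E - \int[jordan_neg nuPN]_x (f x)%:E)%E.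

(* The value of a charge on a non-measurable set carries no meaning, so
   nu = 0 and equality of measures are stated on measurable sets only. *)
Definition separating_set (M : set (charge X R))
    (F : set (X -> R)) : Prop :=
  (forall f, F f -> measurable_fun [set: X] f /\ bounded_fun f) /\
  (forall nu, M nu ->
    (forall A, measurable A -> nu A = 0%E) <->
    (forall f, F f -> charge_integral nu f = 0%E)).

Definition invariant_probabilities (G : Type) (act : G -> X -> X) :
    set (probability X R) :=
  [set mu | forall s A, measurable A -> mu A = pushforward mu (act s) A].

Definition pullback (G : Type) (act : G -> X -> X) (s : G) (f : X -> R) :
    X -> R := fun x => f (act s x).

(* [integrable] means measurable with finite integral of the absolute value. *)
Definition hypothesis_generated (Phi : set (X -> R)) :
    set (probability X R) :=
  [set mu | forall f, Phi f ->
    mu.-integrable [set: X] (EFin \o f) /\ (\int[mu]_x (f x)%:E <= 0)%E].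

Definition invariance_constraints (G : Type) (act : G -> X -> X)
    (S : set G) (F : set (X -> R)) : set (X -> R) :=
  [set pullback act s f \- f | s in S & f in F `|` [set \- g | g in F]].

End measures.

(* Main.v *)
(* For each generator s the signed measure mu - s_* mu integrates f to
   int f dmu - int (f o s) dmu, so a separating set detects whether mu = s_* mu.
   Invariance under the generators passes to finite products, and taking both
   signs of f turns the inequalities of the hypothesis into equalities. *)

Require Import Defs.
From mathcomp Require Import all_boot all_order all_algebra.
From mathcomp Require Import all_classical all_reals all_analysis.

Import Order.TTheory GRing.Theory Num.Theory.
Import numFieldNormedType.Exports.

Local Open Scope classical_set_scope.
Local Open Scope ring_scope.

Section separation.
Context d (X : measurableType d) (R : realType).
Local Open Scope ereal_scope.

Lemma bounded_integrable (m : {finite_measure set X -> \bar R}) (f : X -> R) :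
  measurable_fun [set: X] f -> bounded_fun f ->
  m.-integrable [set: X] (EFin \o f).
Proof.
move=> mf bf; apply: measurable_bounded_integrable => //.
by rewrite ltey_eq fin_num_measure.
Qed.

(** Makes [charge_integral] independent of the Hahn decomposition chosen in its definition: any
    splitting of the charge into two finite measures computes it. *)
Lemma eq_integral_sub (p n m1 m2 : {finite_measure set X -> \bar R})
    (f : X -> R) :
  (forall A, measurable A -> p A - n A = m1 A - m2 A) ->
  measurable_fun [set: X] f -> bounded_fun f ->
  \int[p]_x (f x)%:E - \int[n]_x (f x)%:E =
  \int[m1]_x (f x)%:E - \int[m2]_x (f x)%:E.
Proof.
move=> pnE mf bf.
(* Moving terms across an equation in [\bar R] is sound for finite values; [cross] serves twice, for
   the integrals and for the measures of a set. *)
have cross (a b c e : \bar R) : a \is a fin_num -> b \is a fin_num ->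
    c \is a fin_num -> e \is a fin_num -> a - b = c - e <-> a + e = c + b.
  move: a b c e => [a||] [b||] [c||] [e||] // _ _ _ _.
  rewrite -!EFinB -!EFinD; split=> -[abce]; congr EFin.
    by rewrite -[a](subrK b) abce addrAC subrK.
  by rewrite -[a](addrK e) abce addrAC addrK.
have intf := fun m => @bounded_integrable m f mf bf.
have fin (m : {finite_measure set X -> \bar R}) :
    \int[m]_x (f x)%:E \is a fin_num.
  exact: (integrable_fin_num measurableT (intf m)).
apply/cross; [exact: fin..|].
have addE (m m' : {finite_measure set X -> \bar R}) :
    \int[m]_x (f x)%:E + \int[m']_x (f x)%:E =
    \int[measure_add m m']_x (f x)%:E.
  by rewrite (integral_measure_add measurableT (intf m) (intf m')).
(* [cross] turns the claim into an identity between the sums [p + m2] and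
   [m1 + n], which are genuine measures. *)
rewrite !addE; apply: eq_measure_integral => A mA _.
apply: etrans (measure_addE _ _ _) _; apply/esym/(etrans (measure_addE _ _ _)).
by apply/esym/cross; rewrite ?fin_num_measure ?pnE.
Qed.

(** The Jordan decomposition is itself a splitting of [nu] into two finite measures, so
    [eq_integral_sub] compares it with [m1] and [m2]. *)
Lemma charge_integral_sub (m1 m2 : {finite_measure set X -> \bar R})
    (nu : charge X R) (f : X -> R) :
  (forall A, measurable A -> nu A = m1 A - m2 A) ->
  measurable_fun [set: X] f -> bounded_fun f ->
  charge_integral nu f = \int[m1]_x (f x)%:E - \int[m2]_x (f x)%:E.
Proof.
move=> nuE mf bf; apply: eq_integral_sub mf bf => A mA.
by rewrite -nuE// [RHS](jordan_decomp (projT2 (cid (projT2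
  (cid (Hahn_decomposition nu))))) mA) /cadd/= cscaleN1.
Qed.

(** The separating property is applied to the charge [m1 - m2]; finiteness of the integrals and of
    the values on sets lets a zero difference and an equality be exchanged. *)
Lemma separating_set_eq (F : set (X -> R))
    (m1 m2 : {finite_measure set X -> \bar R}) :
  separating_set [set: charge X R] F ->
  (forall f, F f -> \int[m1]_x (f x)%:E = \int[m2]_x (f x)%:E) ->
  forall A, measurable A -> m1 A = m2 A.
Proof.
move=> [mbF sepF] eqI A mA.
pose nu : charge X R := cadd (charge_of_finite_measure m1)
  (cscale (-1) (charge_of_finite_measure m2)).
have nuE B : measurable B -> nu B = m1 B - m2 B.
  by move=> mB; exact: (congr1 (fun x => m1 B + x) (mulN1e (m2 B))).
have /(_ _ mA) : forall B, measurable B -> nu B = 0.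
  apply/(sepF nu Logic.I) => f Ff; have [mf bf] := mbF f Ff.
  rewrite (charge_integral_sub _ _ _ _ nuE mf bf) eqI// subee//.
  exact: (integrable_fin_num measurableT (bounded_integrable m2 f mf bf)).
by rewrite nuE// => /eqP; rewrite sube_eq ?add0e ?fin_num_adde_defl//
  ?fin_num_measure// => /eqP.
Qed.

End separation.

Section invariance.
Context d (X : measurableType d) (R : realType).
Local Open Scope ereal_scope.

(** By change of variables, the integral of [f \o T] against [mu] is that of [f] against the image
    measure, so the integral condition compares two probability measures on [F]. *)
Lemma pushforward_separated (F : set (X -> R)) (mu : probability X R)
    (T : X -> X) :
  separating_set [set: charge X R] F -> measurable_fun [set: X] T ->
  (forall A, measurable A -> mu A = pushforward mu T A) <->
  (forall f, F f -> \int[mu]_x (f (T x) - f x)%:E = 0).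
Proof.
move=> Fsep mT; have mbF := Fsep.1.
(* Bundling [T] with its measurability makes [distribution mu T'] a probability measure, to which
   [separating_set_eq] applies; it is convertible with [pushforward mu T]. *)
pose T' : {mfun X >-> X} := mfun_Sub (mem_set mT).
have intF f : F f -> mu.-integrable [set: X] (EFin \o f).
  by move=> /mbF[]; exact: bounded_integrable.
have intFT f : F f -> mu.-integrable [set: X] (EFin \o (f \o T)).
  move=> /mbF[mf [M [Mr bf]]]; apply: bounded_integrable.
    exact: measurableT_comp.
  by exists M; split => // x Mx y _; exact: bf.
have pushE f : F f ->
    \int[distribution mu T']_x (f x)%:E = \int[mu]_x (f (T x))%:E.
  move=> Ff; rewrite (@integral_pushforward _ _ _ _ _ _ mT _ _ (EFin \o f))//.
  - exact: (measurable_int mu (intF f Ff)).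
  - exact: intFT.
have splitE f : F f -> \int[mu]_x (f (T x) - f x)%:E =
    \int[distribution mu T']_x (f x)%:E - \int[mu]_x (f x)%:E.
  move=> Ff; rewrite pushE//.
  by rewrite -(integralB measurableT (intFT f Ff) (intF f Ff)).
split=> [inv f Ff|I0].
  rewrite splitE//.
  have -> : \int[distribution mu T']_x (f x)%:E = \int[mu]_x (f x)%:E.
    by apply: eq_measure_integral => A mA _; rewrite [RHS]inv.
  by rewrite subee// (integrable_fin_num measurableT (intF f Ff)).
apply: (@separating_set_eq _ _ _ F mu (distribution mu T')) => // f Ff.
have := I0 f Ff; rewrite splitE// => /eqP.
rewrite sube_eq ?add0e; first by move=> /eqP.
  by rewrite pushE//; exact: (integrable_fin_num measurableT (intFT f Ff)).
by rewrite fin_num_adde_defl// (integrable_fin_num measurableT (intF f Ff)).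
Qed.

Lemma measurable_act (G : topologicalGroupType) (act : G -> X -> X) (s : G) :
  measurable_action act -> measurable_fun [set: X] (act s).
Proof.
by move=> mact; exact: (measurable_fun_pair2 (s : borel_group G) mact).
Qed.

(** The maps preserving [mu] include the identity and are closed under composition, so induction
    along a product of generators suffices. *)
Lemma generating_invariant (G : groupType) (act : G -> X -> X) (S : set G)
    (mu : probability X R) :
  left_action act -> (forall s, measurable_fun [set: X] (act s)) ->
  generating_set S ->
  (forall s, S s ->
    forall A, measurable A -> mu A = pushforward mu (act s) A) ->
  invariant_probabilities act mu.
Proof.
move=> [act1 actM] mact genS invS g A.
have [n [s [_ Ss ->]]] := genS g.
(* The set [A] stays universally quantified: for a product [x * y], invariance under [y] is used on
   the preimage of [A] under [act x]. *)
elim/big_ind: _ A => [A _|x y invx invy A mA|i _ A mA]; last exact: invS.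
- rewrite /pushforward; congr (mu _).
  by apply/seteqP; split=> x /=; rewrite act1.
- rewrite invx// /pushforward invy.
    by congr (mu _); apply/seteqP; split=> z /=; rewrite actM.
  by rewrite -[X in measurable X]setTI; exact: mact.
Qed.

(** The constraint for [\- f] is the negative of the one for [f], so the two inequalities squeeze
    the integral to zero; boundedness supplies integrability. *)
Lemma hypothesis_invariance_constraintsE (G : Type) (act : G -> X -> X)
    (S : set G) (F : set (X -> R)) (mu : probability X R) :
  (forall s, measurable_fun [set: X] (act s)) ->
  (forall f, F f -> measurable_fun [set: X] f /\ bounded_fun f) ->
  hypothesis_generated (invariance_constraints act S F) mu <->
  (forall s f, S s -> F f -> \int[mu]_x (f (act s x) - f x)%:E = 0).
Proof.
move=> mact mbF.
have intFB s f : F f ->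
    mu.-integrable [set: X] (EFin \o (pullback act s f \- f)%R).
  move=> /mbF[mf bf].
  have intf : mu.-integrable [set: X] (EFin \o f) by exact: bounded_integrable.
  have intfs : mu.-integrable [set: X] (EFin \o pullback act s f).
    apply: bounded_integrable; first exact: (measurableT_comp mf (mact s)).
    by have [M [Mr Mf]] := bf; exists M; split => // x Mx y _; exact: Mf.
  exact: (integrableB measurableT intfs intf).
have NE s (f : X -> R) : (pullback act s (\- f) \- (\- f))%R =
    (\- (pullback act s f \- f))%R.
  by apply/funext => x; rewrite /pullback/= opprB opprK addrC.
have intN s f : F f -> \int[mu]_x ((\- (pullback act s f \- f))%R x)%:E =
    - \int[mu]_x (f (act s x) - f x)%:E.
  by move=> Ff; rewrite -integralN//; exact: integrable_add_def (intFB s f Ff).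
split=> [hyp s f Ss Ff|I0 _ [s Ss [f Ff <-]]].
  have le0 g : (F `|` [set (\- h)%R | h in F]) g ->
      \int[mu]_x ((pullback act s g \- g)%R x)%:E <= 0.
    by move=> Fg; apply: (hyp _ _).2; exists s => //; exists g.
  have ge0 : \int[mu]_x ((pullback act s (\- f) \- (\- f))%R x)%:E <= 0.
    by apply: le0; right; exists f.
  (* The constraint at [\- f] becomes the lower bound 0 on the integral for [f]; the constraint at
     [f] gives the upper bound. *)
  move: ge0; rewrite NE intN// leeNl oppe0 => ge0.
  by apply/eqP; rewrite eq_le ge0 andbT; apply: le0; left.
case: Ff => [Ff|[g Fg <-]]; first by split; [exact: intFB|rewrite I0].
rewrite NE; split; last by rewrite intN// I0// oppe0.
exact: (integrableN (intFB s g Fg)).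
Qed.

End invariance.

Theorem theorem5p6 (R : realType) (Sigma : topologicalGroupType)
    (d : measure_display) (X : measurableType d) (act : Sigma -> X -> X)
    (Sigma_compact : compact [set: Sigma])
    (act_left : left_action act) (act_meas : measurable_action act)
    (F : set (X -> R)) (F_sep : separating_set [set: charge X R] F)
    (Sigma0 : set Sigma) (Sigma0_gen : generating_set Sigma0) :
  (forall mu : probability X R,
     invariant_probabilities act mu <->
     (forall s f, Sigma0 s -> F f ->
        (\int[mu]_x (f (act s x) - f x)%:E = 0)%E)) /\
  invariant_probabilities act =
    hypothesis_generated (invariance_constraints act Sigma0 F).
Proof.
have mact s : measurable_fun [set: X] (act s) by exact: measurable_act.
have invE (mu : probability X R) : invariant_probabilities act mu <->
    (forall s f, Sigma0 s -> F f ->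
       (\int[mu]_x (f (act s x) - f x)%:E = 0)%E).
  have sepE s := @pushforward_separated _ _ _ F mu (act s) F_sep (mact s).
  split=> [inv s f _ Ff|I0].
    exact: ((sepE s).1 (inv s) f Ff).
  apply: (generating_invariant _ _ _ _ _ _ mu act_left mact Sigma0_gen) => s Ss.
  apply: (sepE s).2 => f; exact: I0.
(* Both sets are described by the same integral condition on the generators. *)
split=> //; apply/seteqP; split=> mu.
  move=> /invE ?; apply/hypothesis_invariance_constraintsE => //.
  exact: F_sep.1.
move=> hyp; apply/invE/hypothesis_invariance_constraintsE => //.
exact: F_sep.1.
Qed.
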